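(* Let $R\subseteq S$ be rings and let $M$ be a right $S$-module. If $\mathrm{End}(M_R)$ is semiprimary (resp. right perfect; semiperfect and $\pi_\infty$-regular; semiperfect and $\pi$-regular), then so is $\mathrm{End}(M_S)$, and there exists $n\in\mathbb{N}$ such that $\mathrm{Jac}(\mathrm{End}(M_S))^n\subseteq\mathrm{Jac}(\mathrm{End}(M_R))$.
   Context: All rings are unital and subrings share the unity of the ambient ring. $\mathrm{End}(M_R)$, $\mathrm{End}(M_S)$ are the rings of $R$-linear, resp. $S$-linear, endomorphisms of $M$. $\mathrm{Jac}$ is the Jacobson radical. A ring $R$ is semilocal if $R/\mathrm{Jac}(R)$ is semisimple artinian; semiperfect if it is semilocal and idempotents lift modulo $\mathrm{Jac}(R)$; semiprimary if it is semilocal and $\mathrm{Jac}(R)$ is nilpotent; right perfect if it is semilocal and $\mathrm{Jac}(R)$ is right T-nilpotent, i.e. for every sequence $x_1,x_2,\dots\in\mathrm{Jac}(R)$ the sequence $x_1,\,x_2x_1,\,x_3x_2x_1,\dots$ eventually vanishes. $R$ is $\pi$-regular if for every $a\in R$ the chain $aR\supseteq a^2R\supseteq a^3R\supseteq\cdots$ stabilizes; $R$ is $\pi_\infty$-regular if $\mathrm{M}_n(R)$ is $\pi$-regular for all $n\in\mathbb{N}$. *)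

(* Defs.v *)
(* Rings are pzRingType's, so that the zero ring, e.g. End(0), is allowed. *)
From HB Require Import structures.
From mathcomp Require Import all_boot all_algebra.
From mathcomp Require Import boolp classical_sets functions.

Set Implicit Arguments.
Unset Strict Implicit.
Unset Printing Implicit Defensive.

Import GRing.Theory.
Local Open Scope classical_set_scope.
Local Open Scope quotient_scope.
Local Open Scope ring_scope.

Section RightIdeals.
Variable A : pzRingType.

Definition right_ideal (I : set A) : Prop :=
  [/\ I 0, forall x y, I x -> I y -> I (x - y)
    & forall x a, I x -> I (x * a)].

Definition maximal_right_ideal (I : set A) : Prop :=
  [/\ right_ideal I, I <> setT
    & forall J, right_ideal J -> I `<=` J -> J = I \/ J = setT].

(* Equal to all of A when A is the zero ring. *)
Definition jac : {pred A} :=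
  fun x => `[< forall I, maximal_right_ideal I -> I x >].

Definition ideal_mul (I J : set A) : set A :=
  [set x | exists (m : nat) (y z : 'I_m -> A),
     [/\ forall i, I (y i), forall i, J (z i) & x = \sum_(i < m) y i * z i]].

Fixpoint ideal_exp (I : set A) (n : nat) : set A :=
  if n is k.+1 then ideal_mul (ideal_exp I k) I else setT.

(* The module A_A is semisimple: every submodule is a direct summand. *)
Definition semisimple : Prop :=
  forall I, right_ideal I -> exists J,
    [/\ right_ideal J, I `&` J = [set 0]
      & forall x, exists y z, [/\ I y, J z & x = y + z]].

Definition right_artinian : Prop :=
  forall I : nat -> set A, (forall k, right_ideal (I k)) ->
    (forall k, I k.+1 `<=` I k) ->
    exists n, forall k, (n <= k)%N -> I k = I n.

Definition semisimple_artinian : Prop := semisimple /\ right_artinian.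

Definition pi_regular : Prop :=
  forall a : A, exists n, forall k, (n <= k)%N ->
    range (fun x => a ^+ k * x) = range (fun x => a ^+ n * x).

End RightIdeals.

Arguments jac : clear implicits.

Section JacobsonQuotient.
Variable A : pzRingType.

Lemma jacP (x : A) :
  reflect (forall I, maximal_right_ideal I -> I x) (x \in jac A).
Proof. exact: asboolP. Qed.

Lemma jac_zmod_closed : zmod_closed (jac A).
Proof.
split; first by apply/jacP => I [[]].
move=> x y /jacP xJ /jacP yJ; apply/jacP => I Imax.
by case: (Imax) => [[_ IB _] _ _]; apply: IB; [apply: xJ | apply: yJ].
Qed.

HB.instance Definition _ := GRing.isZmodClosed.Build A (jac A) jac_zmod_closed.

Lemma jacMr (x a : A) : x \in jac A -> x * a \in jac A.
Proof.
move=> /jacP xJ; apply/jacP => I Imax.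
by case: (Imax) => [[_ _ IM] _ _]; apply: IM; apply: xJ.
Qed.

Lemma right_idealD (I : set A) x y : right_ideal I -> I x -> I y -> I (x + y).
Proof.
move=> [I0 IB _] Ix Iy; rewrite -[y]opprK; apply: (IB) => //.
by rewrite -sub0r; apply: IB.
Qed.

Lemma jacMl (a x : A) : x \in jac A -> a * x \in jac A.
Proof.
move=> /jacP xJ; apply/jacP => I Imax; have [Irid _ Isup] := Imax.
have [I0 IB IM] := Irid.
have [Ia|nIa] := pselect (I a); first exact: IM.
apply: (xJ [set y | I (a * y)]); split.
- split=> [|y z|y b] /=; first by rewrite mulr0.
  + by rewrite mulrBr; exact: IB.
  + by rewrite mulrA; exact: IM.
- move=> eqT; apply: nIa; have : [set y | I (a * y)] 1 by rewrite eqT.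
  by rewrite /= mulr1.
move=> J [J0 JB JM] subJ.
have [JI|nJI] := pselect (J `<=` [set y | I (a * y)]).
  by left; rewrite eqEsubset.
right; have [y Jy nIy] : exists2 y, J y & ~ I (a * y).
  apply: contrapT => nex; apply: nJI => y Jy /=.
  by apply: contrapT => nIy; apply: nex; exists y.
pose K := [set z | exists r k, I k /\ z = a * y * r + k].
have Krid : right_ideal K.
  split=> [|_ _ [r [k [Ik ->]]] [r' [k' [Ik' ->]]]|_ b [r [k [Ik ->]]]].
  - by exists 0, 0; rewrite mulr0 addr0.
  - exists (r - r'), (k - k'); split; first exact: IB.
    by rewrite mulrBr opprD addrACA.
  - by exists (r * b), (k * b); rewrite mulrDl mulrA; split=> //; exact: IM.
have IK : I `<=` K by move=> k Ik; exists 0, k; rewrite mulr0 add0r.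
case: (Isup K Krid IK) => KE.
  case: nIy; rewrite -KE; exists 1, 0.
  by rewrite mulr1 addr0.
have [r [k [Ik ak]]] : K a by rewrite KE.
have J1 : J 1.
  rewrite -[1](subrK (y * r)); apply: right_idealD; first by split.
  - apply: subJ; rewrite /= mulrBr mulr1 mulrA {1}ak addrC addKr.
    exact: Ik.
  - exact: JM.
by apply/seteqP; split=> // z _; rewrite -[z]mul1r; exact: JM.
Qed.

(* MathComp's ring structure on Quotient.quot is restricted to commutative    *)
(* rings.                                                                     *)
Definition jac_quot := Quotient.quot (jac A).

HB.instance Definition _ := EqQuotient.on jac_quot.
HB.instance Definition _ := GRing.Zmodule.on jac_quot.

Definition jac_quot_one : jac_quot := \pi_jac_quot 1.
Definition jac_quot_mul (x y : jac_quot) : jac_quot :=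
  \pi_jac_quot (repr x * repr y).

Lemma jac_quotP (x y : A) :
  reflect (\pi_jac_quot x = \pi_jac_quot y) (x - y \in jac A).
Proof. by rewrite Quotient.idealrBE; exact: eqP. Qed.

Lemma pi_jac_quotD (x y : A) :
  \pi_jac_quot (x + y) = \pi_jac_quot x + \pi_jac_quot y.
Proof. exact: (Quotient.pi_add (jac A)). Qed.

Lemma pi_jac_quotM (x y : A) :
  \pi_jac_quot (x * y) = jac_quot_mul (\pi_jac_quot x) (\pi_jac_quot y).
Proof.
have rJ (z : A) : z - repr (\pi_jac_quot z) \in jac A.
  by apply/jac_quotP; rewrite reprK.
apply/jac_quotP; set x' := repr _; set y' := repr _.
rewrite -(subrK (x * y') (x * y)) -addrA -mulrBr -mulrBl.
by apply: rpredD; [apply: jacMl | apply: jacMr]; exact: rJ.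
Qed.

Lemma jac_quot_mulA : associative jac_quot_mul.
Proof.
elim/quotW=> x; elim/quotW=> y; elim/quotW=> z.
by rewrite -(pi_jac_quotM y z) -(pi_jac_quotM x y) -(pi_jac_quotM x)
  -(pi_jac_quotM (x * y)) mulrA.
Qed.

Lemma jac_quot_mul1 : left_id jac_quot_one jac_quot_mul.
Proof. by elim/quotW=> x; rewrite -(pi_jac_quotM 1 x) mul1r. Qed.

Lemma jac_quot_mulr1 : right_id jac_quot_one jac_quot_mul.
Proof. by elim/quotW=> x; rewrite -(pi_jac_quotM x 1) mulr1. Qed.

Lemma jac_quot_mulDl : left_distributive jac_quot_mul +%R.
Proof.
elim/quotW=> x; elim/quotW=> y; elim/quotW=> z.
by rewrite -(pi_jac_quotD x y) -(pi_jac_quotM x z) -(pi_jac_quotM y z)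
  -(pi_jac_quotM (x + y) z) -pi_jac_quotD mulrDl.
Qed.

Lemma jac_quot_mulDr : right_distributive jac_quot_mul +%R.
Proof.
elim/quotW=> x; elim/quotW=> y; elim/quotW=> z.
by rewrite -(pi_jac_quotD y z) -(pi_jac_quotM x y) -(pi_jac_quotM x z)
  -(pi_jac_quotM x (y + z)) -pi_jac_quotD mulrDr.
Qed.

HB.instance Definition _ := GRing.Zmodule_isPzRing.Build jac_quot
  jac_quot_mulA jac_quot_mul1 jac_quot_mulr1 jac_quot_mulDl jac_quot_mulDr.

End JacobsonQuotient.

Section RingClasses.
Variable A : pzRingType.

Definition semilocal : Prop := semisimple_artinian (jac_quot A).

Definition idempotents_lift : Prop :=
  forall e : jac_quot A, e * e = e ->
    exists f : A, f * f = f /\ \pi_(jac_quot A) f = e.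

Definition semiperfect : Prop := semilocal /\ idempotents_lift.

Definition jac_nilpotent : Prop :=
  exists n, ideal_exp [set` jac A] n = [set 0].

Definition semiprimary : Prop := semilocal /\ jac_nilpotent.

Fixpoint left_partial_prod (x : nat -> A) (k : nat) : A :=
  if k is j.+1 then x k * left_partial_prod x j else x 0%N.

Definition right_T_nilpotent (I : set A) : Prop :=
  forall x : nat -> A, (forall k, I (x k)) ->
    exists n, forall k, (n <= k)%N -> left_partial_prod x k = 0.

Definition right_perfect : Prop :=
  semilocal /\ right_T_nilpotent [set` jac A].

Definition pi_infty_regular : Prop := forall n : nat, pi_regular 'M[A]_n.

End RingClasses.

(* A right S-module is a left module over the converse ring S^c, m s being    *)
(* written s *: m.  For a subring R of S, endo M R is End(M_R); in particular *)
(* endo M predT is End(M_S).                                                  *)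
Section Endomorphisms.
Variables (S : pzRingType) (M : lmodType S^c).

Definition is_endo (R : {pred S}) : {pred M -> M} := fun f =>
  `[< {morph f : m1 m2 / m1 + m2} /\
      forall (r : S) (m : M), r \in R ->
        f ((r : S^c) *: m) = (r : S^c) *: f m >].

Section EndoRing.
Variable R : {pred S}.

Lemma is_endoP (f : M -> M) :
  reflect ({morph f : m1 m2 / m1 + m2} /\
           forall (r : S) (m : M), r \in R ->
             f ((r : S^c) *: m) = (r : S^c) *: f m) (f \in is_endo R).
Proof. exact: asboolP. Qed.

Lemma is_endo_zmod_closed : zmod_closed (is_endo R).
Proof.
split; first by apply/is_endoP; split=> [m1 m2|r m _] /=;
  rewrite ?addr0 ?scaler0.
move=> f g /is_endoP[fD fZ] /is_endoP[gD gZ]; apply/is_endoP.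
split=> [m1 m2|r m rR]; rewrite !fctE.
  by rewrite fD gD opprD addrACA.
by rewrite fZ // gZ // scalerBr.
Qed.

HB.instance Definition _ :=
  GRing.isZmodClosed.Build (M -> M) (is_endo R) is_endo_zmod_closed.

Record endo := Endo { endo_fun :> M -> M; endo_funP : endo_fun \in is_endo R }.

HB.instance Definition _ := [isSub for endo_fun].
HB.instance Definition _ := [Choice of endo by <:].
HB.instance Definition _ := [SubChoice_isSubZmodule of endo by <:].

Lemma endoD (f : endo) : {morph f : m1 m2 / m1 + m2}.
Proof. by case/is_endoP: (endo_funP f). Qed.

Lemma endoZ (f : endo) (r : S) (m : M) :
  r \in R -> f ((r : S^c) *: m) = (r : S^c) *: f m.
Proof. by case/is_endoP: (endo_funP f) => _; exact. Qed.

Lemma endo_one_subproof : id \in is_endo R.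
Proof. by apply/is_endoP; split. Qed.

Lemma endo_mul_subproof (f g : endo) : f \o g \in is_endo R.
Proof.
by apply/is_endoP; split=> [m1 m2|r m rR] /=; rewrite ?endoD ?endoZ.
Qed.

Definition endo_one : endo := Endo endo_one_subproof.
Definition endo_mul (f g : endo) : endo := Endo (endo_mul_subproof f g).

Lemma endo_mulA : associative endo_mul.
Proof. by move=> f g h; apply/val_inj. Qed.

Lemma endo_mul1 : left_id endo_one endo_mul.
Proof. by move=> f; apply/val_inj. Qed.

Lemma endo_mulr1 : right_id endo_one endo_mul.
Proof. by move=> f; apply/val_inj. Qed.

Lemma endo_mulDl : left_distributive endo_mul +%R.
Proof. by move=> f g h; apply/val_inj. Qed.

Lemma endo_mulDr : right_distributive endo_mul +%R.
Proof. by move=> f g h; apply/val_inj/funext => m; rewrite /= endoD. Qed.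

HB.instance Definition _ := GRing.Zmodule_isPzRing.Build endo
  endo_mulA endo_mul1 endo_mulr1 endo_mulDl endo_mulDr.

End EndoRing.

Lemma endo_restr_subproof (R R' : {pred S}) (f : M -> M) :
  {subset R <= R'} -> f \in is_endo R' -> f \in is_endo R.
Proof.
move=> sRR' /is_endoP[fD fZ]; apply/is_endoP; split=> // r m rR.
exact/fZ/sRR'.
Qed.

(* The inclusion of End(M_S) in End(M_R). *)
Definition endo_incl (R : {pred S}) (f : endo predT) : endo R :=
  Endo (endo_restr_subproof (fun (r : S) (_ : r \in R) => isT) (endo_funP f)).

End Endomorphisms.

(* Jac(End(M_S))^n is contained in Jac(End(M_R)) for some n > 0. *)
Definition jac_exp_incl (S : pzRingType) (M : lmodType S^c) (R : {pred S}) :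
    Prop :=
  exists2 n : nat, (0 < n)%N &
    forall f : endo M predT,
      ideal_exp [set` jac (endo M predT)] n f ->
      endo_incl R f \in jac (endo M R).

(* Main.v *)
Require Import Defs.
From HB Require Import structures.
From mathcomp Require Import all_boot all_algebra.
From mathcomp Require Import boolp classical_sets functions.

Set Implicit Arguments.
Unset Strict Implicit.
Unset Printing Implicit Defensive.

Import GRing.Theory.
Local Open Scope classical_set_scope.
Local Open Scope quotient_scope.
Local Open Scope ring_scope.

(* Write A = End(M_R) and B = End(M_S), a subring of A.  In all four cases A  *)
(* is strongly pi-regular: every a in A has a power a^n with a group inverse  *)
(* g, i.e. a Fitting decomposition.  Under pi-regularity this is Dischinger's *)
(* theorem; under right perfectness the Fitting idempotent of a modulo Jac(A) *)
(* is lifted and then corrected by an iteration which T-nilpotency stops.     *)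
(* A group inverse commutes with everything that commutes with the element,   *)
(* and B is the commutant of S in A, so B is strongly pi-regular too.  Hence  *)
(* Jac(B) is nil and idempotents lift modulo it.  Distinct nested idempotents *)
(* of B generate distinct right ideals of the artinian ring A / Jac(A), so 1  *)
(* is a finite sum of primitive idempotents of B, each generating a simple    *)
(* right ideal of B / Jac(B).  Finally the image of Jac(B) in the semisimple  *)
(* ring A / Jac(A) is nil and closed under products, hence nilpotent.         *)

(** * Right ideals and the Jacobson radical *)

(** Strong pi-regularity is the property that descends: a group inverse is determined by its
    element, so [group_inverse_comm] keeps it inside every commutant
    ([strongly_pi_regular_commutant], and entrywise [strongly_pi_regular_commutant_mx]). It comes
    from [pi_regular_strongly] or [right_perfect_strongly_pi_regular]. Together with semilocality of
    A it gives [semiperfect_sub] and [ex_jac_exp_sub]. The inclusion of Jac(B)^n in Jac(A) then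
    transports the conditions on the radical ([jac_nilpotent_sub], [right_T_nilpotent_sub]). *)

Section RightIdealTheory.
Variable A : pzRingType.
Implicit Types (I J U : set A) (x y : A).

Lemma right_ideal0 I : right_ideal I -> I 0.
Proof. by case. Qed.

Lemma right_idealMr I x a : right_ideal I -> I x -> I (x * a).
Proof. by case=> _ _; exact. Qed.

Lemma right_idealB I x y : right_ideal I -> I x -> I y -> I (x - y).
Proof. by case=> _ + _; exact. Qed.

Lemma right_ideal_set0 : right_ideal [set 0 : A].
Proof.
by split=> [//|_ _ -> ->|_ a ->] /=; rewrite ?subr0 // mul0r.
Qed.

Lemma right_ideal_setT : right_ideal [set: A].
Proof. by split. Qed.

Lemma right_idealI I J :
  right_ideal I -> right_ideal J -> right_ideal (I `&` J).
Proof.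
move=> Ir Jr; split=> [|x y [Ix Jx] [Iy Jy]|x a [Ix Jx]].
- by split; exact: right_ideal0.
- by split; exact: right_idealB.
- by split; exact: right_idealMr.
Qed.

Definition sumset I J : set A :=
  [set x | exists y z, [/\ I y, J z & x = y + z]].

Lemma right_ideal_sumset I J :
  right_ideal I -> right_ideal J -> right_ideal (sumset I J).
Proof.
move=> Ir Jr; split.
- by exists 0, 0; split; rewrite ?addr0 //; exact: right_ideal0.
- move=> _ _ [y [z [Iy Jz ->]]] [y' [z' [Iy' Jz' ->]]].
  exists (y - y'), (z - z'); rewrite opprD addrACA.
  by split=> //; exact: right_idealB.
- move=> _ a [y [z [Iy Jz ->]]]; exists (y * a), (z * a).
  by rewrite mulrDl; split=> //; exact: right_idealMr.
Qed.

Lemma sub_sumsetl I J : right_ideal J -> I `<=` sumset I J.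
Proof. by move=> Jr x Ix; exists x, 0; rewrite addr0; split=> //; case: Jr. Qed.

Lemma sub_sumsetr I J : right_ideal I -> J `<=` sumset I J.
Proof. by move=> Ir x Jx; exists 0, x; rewrite add0r; split=> //; case: Ir. Qed.

Lemma sumset_sub I J U :
  right_ideal U -> I `<=` U -> J `<=` U -> sumset I J `<=` U.
Proof.
move=> Ur IU JU _ [y [z [Iy Jz ->]]].
by apply: right_idealD; [|exact: IU|exact: JU].
Qed.

Lemma right_ideal_lmul x I : right_ideal I -> right_ideal [set x * y | y in I].
Proof.
move=> Ir; split.
- by exists 0; rewrite ?mulr0 //; case: Ir.
- move=> _ _ [y Iy <-] [z Iz <-]; exists (y - z); last by rewrite mulrBr.
  exact: right_idealB.
- move=> _ a [y Iy <-]; exists (y * a); last by rewrite mulrA.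
  exact: right_idealMr.
Qed.

Lemma right_ideal_bigcup (I_ : nat -> set A) :
    (forall k, right_ideal (I_ k)) -> (forall k, I_ k `<=` I_ k.+1) ->
  right_ideal (\bigcup_k I_ k).
Proof.
move=> Ir Iinc.
have Imono i j : (i <= j)%N -> I_ i `<=` I_ j.
  move=> /subnK <-; elim: (j - i)%N => [|d IHd] //=.
  by rewrite addSn; apply: subset_trans IHd (Iinc _).
split.
- by exists 0%N => //; exact: right_ideal0.
- move=> x y [i _ Ix] [j _ Iy]; exists (maxn i j) => //.
  by apply: right_idealB; [|apply: Imono Ix|apply: Imono Iy];
    rewrite ?leq_maxl ?leq_maxr.
- by move=> x a [i _ Ix]; exists i => //; exact: right_idealMr.
Qed.

Lemma exists_maximal_right_ideal I : right_ideal I -> ~ I 1 ->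
  exists2 K, maximal_right_ideal K & I `<=` K.
Proof.
move=> Ir nI1.
(* Zorn_bigcup also covers the empty chain, hence the empty set in P. *)
pose P (X : set A) := X = set0 \/ [/\ right_ideal X, ~ X 1 & I `<=` X].
have [|K [PK Kmax]] := @Zorn_bigcup A P.
- move=> F FP Ftot.
  have [[X0 FX0 X0n]|allE] := pselect (exists2 X, F X & X <> set0); last first.
    left; apply/seteqP; split=> // x [X FX Xx].
    by apply: allE; exists X => // XE; rewrite XE in Xx.
  have FPX X x : F X -> X x -> [/\ right_ideal X, ~ X 1 & I `<=` X].
    by move=> FX Xx; have [XE|//] := FP X FX; rewrite XE in Xx.
  have [x0 Xx0] : X0 !=set0 by apply/set0P/eqP.
  right; split.
  + split=> [|x y [X FX Xx] [Y FY Yy]|x a [X FX Xx]].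
    * by exists X0 => //; case: (FPX _ _ FX0 Xx0) => -[].
    * have [Xr _ _] := FPX _ _ FX Xx; have [Yr _ _] := FPX _ _ FY Yy.
      have [XY|YX] := Ftot X Y FX FY.
        by exists Y => //; apply: right_idealB => //; exact: XY.
      by exists X => //; apply: right_idealB => //; exact: YX.
    * have [Xr _ _] := FPX _ _ FX Xx.
      by exists X => //; exact: right_idealMr.
  + by move=> [X FX X1]; case: (FPX _ _ FX X1).
  + move=> x Ix; exists X0 => //; by have [_ _] := FPX _ _ FX0 Xx0; apply.
have [Kr nK1 IK] : [/\ right_ideal K, ~ K 1 & I `<=` K].
  have [KE|//] := PK; exfalso; apply: (Kmax I); last by right; split.
  rewrite KE; split=> // I0; exact: (I0 0 (right_ideal0 Ir)).
exists K => //; split=> //; first by move=> KE; apply: nK1; rewrite KE.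
move=> J Jr KJ; have [J1|nJ1] := pselect (J 1).
  right; apply/seteqP; split=> // x _; rewrite -[x]mul1r.
  exact: right_idealMr.
left; apply: contrapT => JK; apply: (Kmax J).
  by split=> // JK'; apply: JK; apply/seteqP.
by right; split=> //; apply: subset_trans KJ.
Qed.

(** Otherwise (1 - x)A lies in a maximal right ideal, which also contains [x], hence 1. *)
Lemma jac_rinv x : x \in jac A -> exists r, (1 - x) * r = 1.
Proof.
move=> xJ; apply: contrapT => nr.
have [|[r _ r1]|K Kmax sK] :=
  @exists_maximal_right_ideal [set (1 - x) * y | y in setT].
- exact/right_ideal_lmul/right_ideal_setT.
- by apply: nr; exists r.
- have [Kr KT _] := Kmax; apply: KT; apply/seteqP; split=> // y _.
  rewrite -[y]mul1r; apply: right_idealMr => //.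
  rewrite -[1](subrK x); apply: right_idealD => //; last exact: (jacP x xJ).
  by apply: sK; exists 1; rewrite ?mulr1.
Qed.

Lemma jac_inv x : x \in jac A -> exists r, (1 - x) * r = 1 /\ r * (1 - x) = 1.
Proof.
move=> xJ; have [r xr] := jac_rinv xJ.
have rE : r = 1 - - (x * r).
  by rewrite opprK -xr mulrBl mul1r subrK.
have [s rs] : exists s, r * s = 1.
  by rewrite rE; apply: jac_rinv; rewrite rpredN; exact: jacMr.
exists r; split=> //.
suff -> : 1 - x = s by [].
transitivity ((1 - x) * (r * s)); first by rewrite rs mulr1.
by rewrite mulrA xr mul1r.
Qed.

(** If a maximal [K] misses [x], then K + xA is everything, so some 1 - xa lies in [K]; being right
    invertible, it forces 1 into [K]. *)
Lemma rinv_jac x : (forall a, exists r, (1 - x * a) * r = 1) -> x \in jac A.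
Proof.
move=> xr; apply/jacP => K [Kr KT Kmax]; apply: contrapT => nKx.
pose U := sumset K [set x * y | y in setT].
have xT : right_ideal [set x * y | y in setT].
  exact/right_ideal_lmul/right_ideal_setT.
have Ur : right_ideal U by exact: right_ideal_sumset.
have [UK|UT] := Kmax U Ur (sub_sumsetl xT).
  apply: nKx; rewrite -UK; apply: sub_sumsetr => //.
  by exists 1; rewrite ?mulr1.
have [k [_ [Kk [a _ <-] kE]]] : U 1 by rewrite UT.
have [r kr] := xr a; apply: KT; apply/seteqP; split=> // y _.
rewrite -[y]mul1r -kr {1}kE addrK -mulrA.
exact: right_idealMr.
Qed.

Lemma jac_idem e : e * e = e -> e \in jac A -> e = 0.
Proof.
move=> ee /jac_rinv[r er].
by rewrite -[e]mulr1 -er mulrA mulrBr mulr1 ee subrr mul0r.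
Qed.

Lemma nilpotent_inv x n : x ^+ n = 0 -> exists r, (1 - x) * r = 1.
Proof.
move=> xn; exists (\sum_(i < n) x ^+ i).
by rewrite -[1 - x]opprB mulNr -subrX1 xn sub0r opprK.
Qed.

End RightIdealTheory.

Definition jac_pi (A : pzRingType) (x : A) : jac_quot A := \pi_(jac_quot A) x.

Lemma jac_pi_zmod_morphism (A : pzRingType) : zmod_morphism (@jac_pi A).
Proof.
move=> x y; apply: (@addIr _ (jac_pi y)).
by rewrite subrK -pi_jac_quotD subrK.
Qed.

Lemma jac_pi_monoid_morphism (A : pzRingType) : monoid_morphism (@jac_pi A).
Proof. by split=> // x y; exact: pi_jac_quotM. Qed.

HB.instance Definition _ (A : pzRingType) :=
  GRing.isZmodMorphism.Build A (jac_quot A) (@jac_pi A)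
    (@jac_pi_zmod_morphism A).
HB.instance Definition _ (A : pzRingType) :=
  GRing.isMonoidMorphism.Build A (jac_quot A) (@jac_pi A)
    (@jac_pi_monoid_morphism A).

Lemma jac_piP (A : pzRingType) (x y : A) :
  jac_pi x = jac_pi y <-> x - y \in jac A.
Proof. exact: rwP (jac_quotP x y). Qed.

Lemma jac_pi_eq0 (A : pzRingType) (x : A) : jac_pi x = 0 <-> x \in jac A.
Proof. by rewrite -[0](raddf0 (@jac_pi A)) jac_piP subr0. Qed.

Lemma jac_pi_surj (A : pzRingType) (q : jac_quot A) : exists x, jac_pi x = q.
Proof. by exists (repr q); exact: reprK. Qed.

(** * Group inverses and strong pi-regularity *)

Section GroupInverse.
Variable A : pzRingType.
Implicit Types (a b g t x y : A).

(** Equivalently, [b] and [g] are mutually inverse units of the corner ring of the idempotent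
    [b * g]. *)
Definition group_inverse b g : Prop :=
  [/\ b * g = g * b, b * b * g = b & b * g * g = g].

Lemma group_inverse_idem b g : group_inverse b g -> b * g * (b * g) = b * g.
Proof. by move=> [bg _ bgg]; rewrite {2}bg mulrA bgg bg. Qed.

(** With e = bg, one gets et = ete = te, and then gt = gte = gtbg = etg = tg. *)
Lemma group_inverse_comm b g t : group_inverse b g -> b * t = t * b ->
  g * t = t * g.
Proof.
move=> [bg bbg bgg] bt.
have gbb : g * b * b = b by rewrite -bg -mulrA -bg mulrA.
have gbt : b * g * t = g * t * b by rewrite bg -!mulrA bt.
have et : b * g * t = t * (b * g).
  transitivity (b * g * t * (b * g)).
    by rewrite gbt -[in LHS]bbg !mulrA.
  by rewrite -(mulrA _ t) (mulrA t) -bt {1}bg !mulrA gbb bt.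
transitivity (g * t * (b * g)).
  by rewrite -mulrA -et !mulrA -bg bgg.
by rewrite mulrA -gbt et -!mulrA (mulrA b) bgg.
Qed.

(** The elements bx and yb coincide and are the idempotent; the inverse is ybx. *)
Lemma ex_group_inverse b x y : b = b * b * x -> b = y * b * b ->
  exists g, group_inverse b g.
Proof.
move=> bx yb; have e : b * x = y * b by rewrite {1}yb -!mulrA (mulrA b) -bx.
have byb : b * y * b = b by rewrite -mulrA -e mulrA -bx.
have bg : b * (y * b * x) = b * x by rewrite !mulrA byb.
exists (y * b * x); split.
- by rewrite bg -(mulrA y) e -mulrA -yb.
- by rewrite -mulrA bg mulrA -bx.
- by rewrite bg e !mulrA -(mulrA y b y) -(mulrA y _ b) byb.
Qed.

(** By [ex_group_inverse] this amounts to stabilization of both chains a^n A and A a^n. Exponent 0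
    is excluded because 1 is always its own group inverse. *)
Definition strongly_pi_regular : Prop :=
  forall a, exists n g, (0 < n)%N /\ group_inverse (a ^+ n) g.

Lemma exp_stable a x n k :
  a ^+ n = a ^+ n.+1 * x -> a ^+ n = a ^+ (n + k) * x ^+ k.
Proof.
move=> an; elim: k => [|k IHk]; first by rewrite addn0 mulr1.
rewrite {}[LHS]IHk exprS mulrA addnC exprD an.
by rewrite addnS addnC -addnS exprD !mulrA.
Qed.

Lemma pi_regularP :
  pi_regular A <-> forall a, exists n x, a ^+ n = a ^+ n.+1 * x.
Proof.
split=> [pA a|pA a].
  have [n an] := pA a; have := an n.+1 (leqnSn n) => /seteqP[_ sub].
  have [|x _ ax] := sub (a ^+ n); first by exists 1; rewrite ?mulr1.
  by exists n, x.
have [n [x ax]] := pA a; exists n => k lenk.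
apply/seteqP; split=> _ [y _ <-].
  by exists (a ^+ (k - n) * y) => //; rewrite mulrA -exprD subnKC.
exists (x ^+ (k - n) * y) => //; rewrite mulrA.
by rewrite -{1}(subnKC lenk) -exp_stable.
Qed.

Lemma strongly_pi_regular_pi_regular : strongly_pi_regular -> pi_regular A.
Proof.
move=> sA; apply/pi_regularP => a; have [n [g [n0 [_ bbg _]]]] := sA a.
exists n, (a ^+ n.-1 * g).
by rewrite mulrA -exprD addSn -addnS prednK // exprD bbg.
Qed.

(* Dischinger's theorem: if a = a^2 b and b = b^2 c, then a (a - c) = 0, so   *)
(* (a - c)^(k+1) = (-c)^k (a - c), and the descending chain of a - c forces   *)
(* a b a = a; the right inverse of a in the corner ring of the idempotent a b *)
(* is then two-sided.                                                         *)
Lemma pi_regular_strongly : pi_regular A -> strongly_pi_regular.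
Proof.
move=> /pi_regularP rA.
have r2 a : exists n x, (0 < n)%N /\ a ^+ n = a ^+ n * a ^+ n * x.
  have [n [x ax]] := rA a; exists n.+1, (x ^+ n.+1); split=> //.
  by rewrite -exprD; apply: exp_stable; rewrite exprS ax mulrA -exprS.
move=> a0; have [n [x [n0 ax]]] := r2 a0; have [m [c [m0 bc]]] := r2 x.
(* The two relations are brought to a common exponent by taking the m-th power of the first. *)
have [p [a [b [p0 ap ab {}bc]]]] : exists p a b,
    [/\ (0 < p)%N, a0 ^+ p = a, a = a * a * b & b = b * b * c].
  exists (n * m)%N, (a0 ^+ (n * m)), (x ^+ m); split=> //.
    by rewrite muln_gt0 n0.
  rewrite exprM -exprD; have := @exp_stable (a0 ^+ n) x 1 m.
  rewrite expr1 expr2 => /(_ ax); rewrite add1n => am.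
  case: m m0 am {bc} => // m _ am.
  by rewrite addSn -addnS exprD -mulrA -am -exprSr.
exists p; rewrite ap.
have ac : a * c = a * a.
  by rewrite {1}ab {2}ab -!mulrA (mulrA b) -bc (mulrA a a b) -ab.
have abc : a * b * c = a by rewrite {1}ab -!mulrA (mulrA b) -bc mulrA -ab.
pose z := a - c.
have az : a * z = 0 by rewrite mulrBr ac subrr.
have zS k : z ^+ k.+1 = (- c) ^+ k * z.
  elim: k => [|k IHk]; first by rewrite mul1r.
  by rewrite exprSr IHk -mulrA {2}/z mulrBl az sub0r -mulNr mulrA -exprSr.
have bS k : (- b) ^+ k.+1 * (- c) ^+ k = - b.
  elim: k => [|k IHk]; first by rewrite mulr1.
  rewrite 2!exprSr exprS -!mulrA (mulrA (- b)) (mulrA (- b * - b)).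
  have -> : - b * - b * - c = - b by rewrite mulrNN mulrN -bc.
  by rewrite mulrA -exprSr.
have [k [y [k0 zk]]] := r2 z.
have {k0}[y' {}zk] : exists y', z ^+ k.+1 = z ^+ k.+2 * y'.
  exists (z ^+ k.-1 * y).
  case: k k0 zk => // k _ zk /=.
  by rewrite exprS {1}zk !mulrA -exprS -!exprD addSn addnS.
have bbz : b * b * z = - (b * z * y').
  have := congr1 ( *%R ((- b) ^+ k.+2)) zk; rewrite zS zS !mulrA bS.
  by rewrite exprS -(mulrA (- b)) bS mulrNN !mulNr.
have aba : a * b * a = a.
  apply/eqP; rewrite -subr_eq0 -{3}abc -mulrBr -/z {1}ab.
  rewrite -!mulrA (mulrA b) bbz.
  by rewrite 2!mulrN !mulrA -ab az mul0r oppr0.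
pose v := a * b * b * a * b; pose e := a * b.
have ee : e * e = e by rewrite /e mulrA aba.
have ev : e * v = v by rewrite /e /v !mulrA aba.
have ve : v * e = v by rewrite /v -(mulrA _ a) -/e -mulrA ee.
have av : a * v = e by rewrite /e /v !mulrA -ab aba.
have ae : a * e = a by rewrite /e mulrA -ab.
have ea : e * a = a by [].
clearbody v e.
have avS j : a ^+ j * (v ^+ j * e) = e.
  elim: j => [|j IHj]; first by rewrite !mul1r.
  rewrite exprSr exprS -!mulrA (mulrA a) av -[RHS]IHj; congr (_ * _).
  by rewrite mulrA commrX ?mulrA -?mulrA ?ee // /GRing.comm ev ve.
(* Cancelling v^l on the left by a^l in v^l = v^(2l) w gives v^l w = e, so [v] has a right inverse
   in the corner as well as the left inverse [a]. *)
have [l [w [l0 vw]]] := r2 v.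
have vl : v ^+ l * e = v ^+ l by rewrite -(prednK l0) exprSr -mulrA ve.
have vs : v * (v ^+ l.-1 * w) = e.
  have evl : e * v ^+ l = v ^+ l by rewrite -(prednK l0) exprS mulrA ev.
  have avl : a ^+ l * v ^+ l = e by rewrite -{1}vl avS.
  rewrite mulrA -exprS prednK //; transitivity (a ^+ l * v ^+ l * (v ^+ l * w)).
    by rewrite avl mulrA evl.
  by rewrite -mulrA (mulrA (v ^+ l)) -vw.
have va : v * a = e by rewrite -ae -{1}vs (mulrA a) av mulrA ve vs.
have [//||g ga] := @ex_group_inverse a b v; first by rewrite va.
by exists g.
Qed.

End GroupInverse.

Section StronglyPiRegular.
Variable A : pzRingType.
Hypothesis A_spr : strongly_pi_regular A.

Lemma jac_nil x : x \in jac A -> exists n, x ^+ n = 0.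
Proof.
move=> xJ; have [n [g [n0 gi]]] := A_spr x; exists n.
have /jac_idem e0 := group_inverse_idem gi.
have [xg xxg _] := gi; rewrite -xxg -mulrA e0 ?mulr0 //.
by apply: jacMr; rewrite -(prednK n0) exprS; exact: jacMr.
Qed.

(** For any lift [x] of [q], the idempotent x^n g is a lift too: its image p satisfies p = qp since
    x^n maps to [q], and qp = q since x^n x^n g = x^n. *)
Lemma strongly_pi_regular_idempotents_lift : idempotents_lift A.
Proof.
move=> q qq; have [x xq] := jac_pi_surj q.
have [n [g [n0 gi]]] := A_spr x.
exists (x ^+ n * g); split; first exact: group_inverse_idem.
have qn : jac_pi (x ^+ n) = q.
  rewrite rmorphXn /= xq -(prednK n0).
  by elim: n.-1 => // k IHk; rewrite exprS IHk.
have [_ xxg _] := gi; rewrite -/(jac_pi _).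
have qe : q * jac_pi (x ^+ n * g) = q.
  by rewrite -{1}qn -rmorphM mulrA xxg.
by rewrite -[RHS]qe rmorphM /= qn mulrA qq.
Qed.

End StronglyPiRegular.

(** * Semisimple artinian rings *)

Section SemisimpleSums.
Variable Q : pzRingType.
Implicit Types (I J V W : set Q).

Definition simple_or_zero V : Prop :=
  right_ideal V /\
  forall I, right_ideal I -> I `<=` V -> I `<=` [set 0] \/ V `<=` I.

(** The sums need not be direct; induction on them plays the role of a composition series. *)
Inductive simple_sum : set Q -> Prop :=
| simple_sum0 : simple_sum [set 0]
| simple_sumD W V :
    simple_sum W -> simple_or_zero V -> simple_sum (sumset W V).

Lemma right_ideal_simple_sum W : simple_sum W -> right_ideal W.
Proof.
elim=> [|{}W V _ Wr [Vr _]]; first exact: right_ideal_set0.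
exact: right_ideal_sumset.
Qed.

Lemma simple_sum_join W W' : simple_sum W -> simple_sum W' ->
  exists2 W'', simple_sum W'' & W `<=` W'' /\ W' `<=` W''.
Proof.
move=> Ws; have Wr := right_ideal_simple_sum Ws.
elim=> [|{}W' V W's [U Us [WU W'U]] Vs].
  by exists W => //; split=> // _ ->; exact: right_ideal0.
have Ur := right_ideal_simple_sum Us; have [Vr _] := Vs.
exists (sumset U V); first exact: simple_sumD.
split; first by apply: subset_trans (sub_sumsetl _).
apply: sumset_sub; first exact: right_ideal_sumset.
- by apply: subset_trans (sub_sumsetl _).
- exact: sub_sumsetr.
Qed.

(** A new summand [V] either lies in I + J, and [J] is kept, or meets it in 0, and J + V is still
    independent of [I]. *)
Lemma simple_sum_complement W I : simple_sum W -> right_ideal I ->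
  exists J, [/\ right_ideal J, I `&` J = [set 0] & W `<=` sumset I J].
Proof.
move=> Ws Ir; elim: Ws => [|{}W V Ws [J [Jr IJ WIJ]] [Vr Vs]].
  exists [set 0]; split; first exact: right_ideal_set0.
  - by apply/seteqP; split=> [x []//|_ ->]; split=> //; exact: right_ideal0.
  - exact: sub_sumsetr.
have IJr : right_ideal (sumset I J) by exact: right_ideal_sumset.
have [V0|VIJ] := Vs _ (right_idealI IJr Vr) (@subIsetr _ _ _); last first.
  exists J; split=> //; apply: sumset_sub => //.
  by apply: subset_trans VIJ (@subIsetl _ _ _).
exists (sumset J V); split; first exact: right_ideal_sumset.
- apply/seteqP; split=> [x [Ix [y [v [Jy Vv xE]]]]|_ ->]; last first.
    by split; apply: right_ideal0 => //; exact: right_ideal_sumset.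
  have v0 : v = 0.
    apply: V0; split=> //; exists x, (- y); split=> //.
      by rewrite -sub0r; apply: right_idealB => //; exact: right_ideal0.
    by rewrite xE addrAC subrr add0r.
  by rewrite -IJ; split=> //; rewrite xE v0 addr0.
- have Ur : right_ideal (sumset I (sumset J V)).
    by do 2?apply: right_ideal_sumset.
  apply: sumset_sub => //.
    apply: subset_trans WIJ _; apply: sumset_sub => //.
      by apply: sub_sumsetl; exact: right_ideal_sumset.
    by apply: subset_trans (sub_sumsetr _) => //; exact: sub_sumsetl.
  by apply: subset_trans (sub_sumsetr _) => //; exact: sub_sumsetr.
Qed.

Lemma decreasing_subset (I_ : nat -> set Q) i j :
  (forall k, I_ k.+1 `<=` I_ k) -> (i <= j)%N -> I_ j `<=` I_ i.
Proof.
move=> Idec /subnK <-; elim: (j - i)%N => [|d IHd] //=.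
by rewrite addSn; apply: subset_trans (Idec _) IHd.
Qed.

Lemma simple_sum_dcc W (I_ : nat -> set Q) : simple_sum W ->
    (forall k, right_ideal (I_ k)) -> (forall k, I_ k.+1 `<=` I_ k) ->
  exists n, forall k, (n <= k)%N -> I_ n `&` W `<=` I_ k.
Proof.
move=> Ws Ir Idec; elim: Ws => [|{}W V Ws [n1 WI] [Vr Vs]].
  by exists 0%N => k _ _ [_ ->]; exact: right_ideal0.
have Wr := right_ideal_simple_sum Ws.
(* The V-components of elements of [I_ k]: this right ideal is 0 or [V], so it stabilizes. Two
   elements with the same V-component differ by an element of [W], where induction applies. *)
pose V_ k := [set v | V v /\ exists2 w, W w & I_ k (w + v)].
have V_r k : right_ideal (V_ k).
  split.
  - split; first exact: right_ideal0.
    by exists 0; rewrite ?addr0; exact: right_ideal0.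
  - move=> x y [Vx [w Ww Iwx]] [Vy [z Wz Izy]].
    split; first exact: right_idealB.
    exists (w - z); first exact: right_idealB.
    by rewrite addrACA -opprD; exact: right_idealB.
  - move=> x a [Vx [w Ww Iwx]]; split; first exact: right_idealMr.
    by exists (w * a); [|rewrite -mulrDl]; exact: right_idealMr.
have V_dec k : V_ k.+1 `<=` V_ k.
  by move=> v [Vv [w Ww Iv]]; split=> //; exists w => //; exact: Idec.
have [n2 V_stable] : exists n, forall k, (n <= k)%N -> V_ n `<=` V_ k.
  have V_sub k : V_ k `<=` V by move=> v [].
  have [[n Vn0]|noV0] := pselect (exists n, V_ n `<=` [set 0]).
    by exists n => k _ v /Vn0 ->; exact: right_ideal0.
  exists 0%N => k _; have [V0|VV] := Vs _ (V_r k) (V_sub k).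
    by case: noV0; exists k.
  exact: subset_trans (V_sub _) VV.
exists (maxn n1 n2) => k; rewrite geq_max => /andP[n1k n2k].
move=> _ [/[swap] [[w [v [Ww Vv ->]]]] Iwv].
have [|_ [w' Ww' Iw'v]] := V_stable k n2k v.
  split=> //; exists w => //.
  by apply: (decreasing_subset Idec _ Iwv); exact: leq_maxr.
rewrite -[w](subrK w') -addrA.
apply: right_idealD => //; apply: WI => //.
split; last exact: right_idealB.
have -> : w - w' = (w + v) - (w' + v) by rewrite opprD addrACA subrr addr0.
apply: right_idealB => //; last exact: (decreasing_subset Idec n1k).
by apply: (decreasing_subset Idec _ Iwv); exact: leq_maxl.
Qed.

Lemma simple_sum_semisimple_artinian W :
  simple_sum W -> W 1 -> semisimple_artinian Q.
Proof.
move=> Ws W1; have Wr := right_ideal_simple_sum Ws.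
have WT x : W x by rewrite -[x]mul1r; exact: right_idealMr.
split=> [I Ir|I_ Ir Idec].
  have [J [Jr IJ WIJ]] := simple_sum_complement Ws Ir.
  by exists J; split=> // x; exact: WIJ.
have [n In] := simple_sum_dcc Ws Ir Idec; exists n => k nk.
apply/seteqP; split; first exact: decreasing_subset.
by move=> x Ix; apply: In nk _ _.
Qed.

Lemma artinian_minimal (P : set (set Q)) I : right_artinian Q ->
    (forall J, P J -> right_ideal J) -> P I ->
  exists2 J, P J & forall K, P K -> K `<=` J -> J `<=` K.
Proof.
move=> Qart Pr PI; apply: contrapT => nomin.
have /choice[f fP] : forall J, exists K, P J -> P K /\ K `<` J.
  move=> J; have [PJ|nPJ] := pselect (P J); last by exists J.
  apply: contrapT => nK; apply: nomin; exists J => // K PK KJ.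
  by apply: contrapT => nJK; apply: nK; exists K.
have PI_ k : P (iter k f I) by elim: k => //= k /fP[].
have [n In] := Qart (fun k => iter k f I) (fun k => Pr _ (PI_ k))
  (fun k => (fP _ (PI_ k)).2.1).
by have [_ [_]] := fP _ (PI_ n); rewrite -iterS (In n.+1 (leqnSn n)); apply.
Qed.

End SemisimpleSums.

(** * Nil multiplicative sets in a semisimple artinian ring are nilpotent *)

Section NilSets.
Variables (Q : pzRingType) (N : set Q).
Hypothesis Q_ssa : semisimple_artinian Q.
Hypothesis N_mul : forall x y, N x -> N y -> N (x * y).
Hypothesis N_nil : forall x, N x -> exists n, x ^+ n = 0.

Definition left_stable (K : set Q) : Prop :=
  forall x y, N x -> K y -> K (x * y).

Definition residual (K : set Q) : set Q := [set y | forall x, N x -> K (x * y)].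

Lemma right_ideal_residual K : right_ideal K -> right_ideal (residual K).
Proof.
move=> Kr; split=> [x _|y z Ky Kz x Nx|y a Ky x Nx].
- by rewrite mulr0; exact: right_ideal0.
- by rewrite mulrBr; apply: right_idealB => //; [exact: Ky|exact: Kz].
- by rewrite mulrA; apply: right_idealMr => //; exact: Ky.
Qed.

(* Inside a minimal stable U above K, pick x in N with x U + K minimal above  *)
(* K.  As x y is nilpotent, x y x U + K is strictly smaller for all y in N,   *)
(* so x N x U is in K, and {u in U | x u, x N u in K} is a stable right ideal *)
(* which must be K.                                                           *)
Lemma residual_sub K : right_ideal K -> left_stable K -> residual K `<=` K ->
  K = setT.
Proof.
move=> Kr Ks Kres; apply: contrapT => KT.
have [_ Qart] := Q_ssa.
pose P U := [/\ right_ideal U, left_stable U, K `<=` U & ~ U `<=` K].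
have [||U [Ur Us KU nUK] Umin] := @artinian_minimal _ P setT Qart.
- by move=> J [].
- by split=> // TK; apply: KT; apply/seteqP.
pose lm x := [set x * u | u in U].
have lmr x : right_ideal (lm x) by exact: right_ideal_lmul.
pose P' V := exists2 x, N x /\ ~ lm x `<=` K & V = sumset (lm x) K.
have [x0 [Nx0 x0U]] : exists x, N x /\ ~ lm x `<=` K.
  apply: contrapT => nx; apply: nUK => u Uu; apply: Kres => x Nx.
  apply: contrapT => nKxu; apply: nx; exists x; split=> // sub.
  by apply: nKxu; apply: sub; exists u.
have [||V [x [Nx xU] VE] Vmin] :=
  @artinian_minimal _ P' (sumset (lm x0) K) Qart.
- by move=> _ [x _ ->]; exact: right_ideal_sumset.
- by exists x0.
have xyx y : N y -> lm (x * y * x) `<=` K.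
  move=> Ny; have Nxy := N_mul Nx Ny.
  apply: contrapT => nK; apply: xU.
  have subV : sumset (lm (x * y * x)) K `<=` V.
    rewrite VE; apply: sumset_sub; first exact: right_ideal_sumset.
      move=> _ [u Uu <-]; apply: sub_sumsetl => //.
      by exists (y * x * u); [apply: Us; [exact: N_mul|]|rewrite !mulrA].
    exact: sub_sumsetr.
  have Vsub := Vmin _ (ex_intro2 _ _ _ (conj (N_mul Nxy Nx) nK) erefl) subV.
  have step u : U u ->
      exists u' k, [/\ U u', K k & x * u = x * y * (x * u') + k].
    move=> Uu; have [|_ [k [[u' Uu' <-] Kk ->]]] := Vsub (x * u).
      by rewrite VE; apply: sub_sumsetl => //; exists u.
    by exists u', k; rewrite !mulrA.
  (* The relation is substituted into itself; [K] absorbs the remainders, and nilpotency of xy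
     finally kills the main term. *)
  have steps n u : U u ->
      exists u' k, [/\ U u', K k & x * u = (x * y) ^+ n * (x * u') + k].
    elim: n u => [|n IHn] u Uu.
      by exists u, 0; rewrite mul1r addr0; split=> //; exact: right_ideal0.
    have [u1 [k1 [Uu1 Kk1 ->]]] := step u Uu.
    have [u2 [k2 [Uu2 Kk2 ->]]] := IHn u1 Uu1.
    exists u2, (x * y * k2 + k1); split=> //.
      by apply: right_idealD => //; exact: Ks.
    by rewrite mulrDr addrA exprS !mulrA.
  have [n xyn] := N_nil Nxy; move=> _ [u Uu <-].
  by have [u' [k [_ Kk ->]]] := steps n u Uu; rewrite xyn mul0r add0r.
pose Z := [set u | [/\ U u, K (x * u) & forall y, N y -> K (x * y * u)]].
have ZK : Z `<=` K.
  have Zr : right_ideal Z.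
    split.
    - split=> [||y _]; rewrite ?mulr0; exact: right_ideal0.
    - move=> u v [Uu Ku Yu] [Uv Kv Yv]; split=> [||y Ny]; rewrite ?mulrBr;
        apply: right_idealB => //; [exact: Yu|exact: Yv].
    - move=> u a [Uu Ku Yu]; split=> [||y Ny]; rewrite ?mulrA;
        apply: right_idealMr => //; exact: Yu.
  apply: contrapT => nZK; apply: xU => _ [u Uu <-].
  have UZ : U `<=` Z.
    apply: Umin; last by move=> v [].
    split=> //.
    - move=> y v Ny [Uv _ Kv]; split; first exact: Us.
        by rewrite mulrA; exact: Kv.
      by move=> z Nz; rewrite mulrA -(mulrA x); apply: Kv; exact: N_mul.
    - move=> k Kk; split; [exact: KU|exact: Ks|].
      by move=> y Ny; apply: Ks => //; exact: N_mul.
  by have [_] := UZ u Uu.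
have yxU y u : N y -> U u -> K (y * (x * u)).
  move=> Ny Uu; apply: ZK; split.
  - by rewrite mulrA; apply: Us => //; exact: N_mul.
  - by apply: (xyx y) => //; exists u; rewrite ?mulrA.
  - move=> z Nz; apply: (xyx (z * y)); first exact: N_mul.
    by exists u; rewrite ?mulrA.
apply: nUK => u Uu.
(* As NxU lies in [K], the sum xU + K is stable, so minimality puts [U] inside it. Then NU lies in
   [K], contradicting [Kres]. *)
have UV : U `<=` sumset (lm x) K.
  apply: Umin; last first.
    by apply: sumset_sub => // _ [v Uv <-]; exact: Us.
  split; first exact: right_ideal_sumset.
  - move=> y _ Ny [_ [k [[v Uv <-] Kk ->]]]; rewrite mulrDr.
    apply: sub_sumsetr => //; apply: right_idealD => //; last exact: Ks.
    exact: yxU.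
  - exact: sub_sumsetr.
  - by move=> sub; apply: xU; apply: subset_trans (sub_sumsetl _) sub.
apply: Kres => y Ny; have [_ [k [[v Uv <-] Kk ->]]] := UV u Uu.
by rewrite mulrDr; apply: right_idealD => //; [exact: yxU|exact: Ks].
Qed.

(** The right annihilator of all products of [n] elements of [N]; it contains 1 exactly when all
    these products vanish. *)
Fixpoint left_annihilated (n : nat) : set Q :=
  if n is k.+1 then residual (left_annihilated k) else [set 0].

(** The union of the chain is a direct summand, hence generated by the component of 1 in it. That
    component appears at a finite stage, where the chain stops, and [residual_sub] applies. *)
Lemma left_annihilated_setT : exists n, left_annihilated n = setT.
Proof.
have [Qss _] := Q_ssa.
have Kr n : right_ideal (left_annihilated n).
  elim: n => [|n IHn]; first exact: right_ideal_set0.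
  exact: right_ideal_residual.
have Kinc n : left_annihilated n `<=` left_annihilated n.+1.
  elim: n => [_ -> x _|n IHn y Ky x Nx]; first by rewrite mulr0.
  by apply: IHn; exact: Ky.
have [J [Jr KJ sum]] := Qss _ (right_ideal_bigcup Kr Kinc).
have [y [z [[n _ Kny] Jz yz1]]] := sum 1.
have Kn : \bigcup_k left_annihilated k `<=` left_annihilated n.
  move=> x Kx; have [i _ Kix] := Kx.
  have xE : x = y * x + z * x by rewrite -mulrDl -yz1 mul1r.
  have z0 : z * x = 0.
    suff : [set 0] (z * x) by [].
    rewrite -KJ; split; last exact: right_idealMr.
    have -> : z * x = x - y * x by apply: (canRL (addrK _)); rewrite addrC -xE.
    apply: right_idealB => //; first exact: right_ideal_bigcup.
    by exists n => //; exact: right_idealMr.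
  by rewrite xE z0 addr0; exact: right_idealMr.
exists n; apply: residual_sub => //.
- by move=> x y' Nx /Kinc; exact.
- by move=> x Kx; apply: Kn; exists n.+1.
Qed.

End NilSets.

(** * Right perfect rings *)

Lemma right_artinian_pi_regular (A : pzRingType) :
  right_artinian A -> pi_regular A.
Proof.
move=> Aart a; apply: Aart => [k|k _ [x _ <-]].
  exact/right_ideal_lmul/right_ideal_setT.
by exists (a * x); rewrite ?mulrA -?exprSr.
Qed.

Section RightPerfect.
Variable A : pzRingType.

Lemma jac_pi_inv (x y : A) :
  jac_pi x * jac_pi y = 1 -> jac_pi y * jac_pi x = 1 ->
  exists z, x * z = 1 /\ z * x = 1.
Proof.
have rinv (u v : A) : jac_pi u * jac_pi v = 1 -> exists w, u * w = 1.
  move=> uv; have /jac_inv[r [r1 _]] : 1 - u * v \in jac A.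
    by apply/jac_piP; rewrite rmorphM uv rmorph1.
  by exists (v * r); rewrite mulrA -[u * v](subKr 1).
move=> xy yx; have [z xz] := rinv _ _ xy; have [w yw] := rinv _ _ yx.
have [w' zw'] : exists w', z * w' = 1.
  apply: (@rinv _ x); have -> : jac_pi z = jac_pi y; last exact: yx.
  by rewrite -[LHS]mul1r -yx -mulrA -[jac_pi x * _]rmorphM xz rmorph1 mulr1.
exists z; split=> //; suff -> : x = w' by [].
by rewrite -[LHS]mulr1 -zw' mulrA xz mul1r.
Qed.

(** For x(1 - x) nilpotent, put f = (1 - x)^(n+1) and e = (1 - f)^(n+1). Then x^(n+1) divides e and
    f divides 1 - e, so e(1 - e) = 0. *)
Lemma nil_idempotent_lift (q : jac_quot A) : 
    (forall x, x \in jac A -> exists n, x ^+ n = 0) ->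
  q * q = q -> exists e : A, e * e = e /\ jac_pi e = q.
Proof.
move=> Jnil qq; have [x xq] := jac_pi_surj q.
have /Jnil[n xn] : x * (1 - x) \in jac A.
  apply/jac_pi_eq0; rewrite rmorphM rmorphB rmorph1 /= xq.
  by rewrite mulrBr mulr1 qq subrr.
have {}xn : x ^+ n.+1 * (1 - x) ^+ n.+1 = 0.
  rewrite -exprMn_comm ?exprS ?xn ?mulr0 //.
  by rewrite /GRing.comm mulrBr mulrBl mulr1 mul1r.
pose f := (1 - x) ^+ n.+1; pose e := (1 - f) ^+ n.+1.
have idem r : r * r = r -> forall k, r ^+ k.+1 = r :> jac_quot A.
  by move=> rr; elim=> // k IHk; rewrite exprS IHk.
exists e; split; last first.
  have qq1 : (1 - q) * (1 - q) = 1 - q.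
    by rewrite mulrBr mulr1 mulrBl mul1r qq subrr subr0.
  rewrite /e rmorphXn rmorphB rmorph1 /f rmorphXn rmorphB rmorph1 /= xq.
  by rewrite (idem (1 - q)) // subKr idem.
have [s [xs sx]] : exists s, 1 - f = x * s /\ x * s = s * x.
  exists (\sum_(i < n.+1) (1 - x) ^+ i); split.
    by rewrite /f -opprB subrX1 -mulNr opprB subKr.
  apply: commr_sum => i _; apply: commrX.
  by rewrite /GRing.comm mulrBr mulrBl mulr1 mul1r.
have ef : e * f = 0.
  by rewrite /e xs sx exprMn_comm // -mulrA xn mulr0.
have [t et] : exists t, 1 - e = f * t.
  exists (\sum_(i < n.+1) (1 - f) ^+ i).
  by rewrite /e -opprB subrX1 -mulNr opprB subKr.
apply/eqP; rewrite -subr_eq0 -{3}[e]mulr1 -mulrBr -opprB et.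
by rewrite mulrN mulrA ef mul0r oppr0.
Qed.

Lemma right_T_nilpotent_nil (I : set A) x :
  right_T_nilpotent I -> I x -> exists n, x ^+ n = 0.
Proof.
move=> Tnil Ix; have [n xn] := Tnil (fun=> x) (fun=> Ix).
exists n.+1; rewrite -[RHS](xn n (leqnn n)).
by elim: n {xn} => [|n IHn] //=; rewrite exprS IHn.
Qed.

(* g is idempotent with image stable under a, on which a is invertible, and   *)
(* a^m maps into that image.                                                  *)
Lemma triangular_group_inverse (a g h c : A) m :
  g * a * g = a * g -> a * g * h = g -> c * a * g = g -> g * a ^+ m = a ^+ m ->
  exists b, group_inverse (a ^+ m) b.
Proof.
move=> gag agh cag gam.
have gh k : a ^+ k * g * h ^+ k = g.
  elim: k => [|k IHk]; first by rewrite mul1r mulr1.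
  by rewrite exprSr exprS -!mulrA (mulrA g) (mulrA a) (mulrA a) agh mulrA.
have agk k : g * a ^+ k * g = a ^+ k * g.
  elim: k => [|k IHk]; first by rewrite mulr1 mul1r -{2}agh !mulrA gag agh.
  rewrite exprSr mulrA -(mulrA _ a g) -gag !mulrA IHk -!mulrA.
  by congr (_ * _); rewrite mulrA.
have cg k : c ^+ k * a ^+ k * g = g.
  elim: k => [|k IHk]; first by rewrite !mul1r.
  rewrite exprSr exprS -!mulrA -agk -(mulrA g).
  rewrite (mulrA a) (mulrA c) (mulrA c) cag.
  by rewrite (mulrA g) agk mulrA.
apply: (@ex_group_inverse _ _ (g * h ^+ (m + m) * a ^+ m) (c ^+ m)).
  by rewrite -exprD !mulrA gh gam.
by rewrite -{3}gam mulrA cg gam.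
Qed.

(* Let e lift the Fitting idempotent of a modulo Jac(A).  Iterate the map     *)
(* g |-> a g h, with h the inverse of e a g in e A e, starting from e: this   *)
(* moves the image of g to its image under a, keeping the kernel of e.  The   *)
(* k-th increment is a multiple of a left partial product of elements of      *)
(* Jac(A), so that the iteration reaches a g with a-stable image.             *)
Lemma right_perfect_strongly_pi_regular :
  right_perfect A -> strongly_pi_regular A.
Proof.
move=> [[_ Qart] Tnil] a0.
have Jnil x : x \in jac A -> exists n, x ^+ n = 0.
  by move=> xJ; exact: right_T_nilpotent_nil Tnil xJ.
have sQ : strongly_pi_regular (jac_quot A).
  exact/pi_regular_strongly/right_artinian_pi_regular.
have [n [q [n0 bq_gi]]] := sQ (jac_pi a0).
suff [m [b mb]] : exists m b, group_inverse ((a0 ^+ n) ^+ m.+1) b.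
  by exists (n * m.+1)%N, b; rewrite exprM muln_gt0 n0.
rewrite -rmorphXn /= in bq_gi.
move: (a0 ^+ n) bq_gi => a {a0 n n0} bq_gi.
have [e [ee eq]] := nil_idempotent_lift Jnil (group_inverse_idem bq_gi).
have [d dq] := jac_pi_surj q.
have [bq bbq bqq] := bq_gi.
have eb : jac_pi e * jac_pi a = jac_pi a by rewrite eq -mulrA -bq mulrA.
have be : jac_pi a * jac_pi e = jac_pi a by rewrite eq mulrA.
have qe : jac_pi e * q = q by rewrite eq.
have eq' : q * jac_pi e = q by rewrite eq mulrA -bq.
have [bf fb] : jac_pi a * (1 - jac_pi e) = 0 /\ (1 - jac_pi e) * jac_pi a = 0.
  by rewrite mulrBr mulr1 be mulrBl mul1r eb subrr.
have [qf fq] : q * (1 - jac_pi e) = 0 /\ (1 - jac_pi e) * q = 0.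
  by rewrite mulrBr mulr1 eq' mulrBl mul1r qe subrr.
have ff : (1 - jac_pi e) * (1 - jac_pi e) = 1 - jac_pi e.
  by rewrite mulrBr mulr1 mulrBl mul1r -rmorphM ee subrr subr0.
(* Such a [g] is idempotent, as gg = geg = ge = g, and has the same kernel as [e]. *)
pose good g := [/\ e * g = e, g * e = g & jac_pi g = jac_pi e].
have /choice[H HP] : forall g, exists h, good g ->
    [/\ e * a * g * h = e, h * (e * a * g) = e & h * e = h].
  move=> g; have [gg|ng] := pselect (good g); last by exists 0.
  have [eg ge ge'] := gg; set h := e * a * g.
  have he : h * e = h by rewrite /h -mulrA ge.
  have eh : e * h = h by rewrite /h !mulrA ee.
  have hE : jac_pi h = jac_pi a by rewrite /h !rmorphM /= ge' eb be.
  (* Modulo Jac(A), [h] becomes [a], a unit of the corner of [e] with inverse [q]; adding 1 - e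
     turns both into units of the whole ring. *)
  have [w [uw wu]] : exists w, (h + (1 - e)) * w = 1 /\ w * (h + (1 - e)) = 1.
    apply: (@jac_pi_inv _ (d + (1 - e)));
      rewrite !rmorphD !rmorphN !rmorph1 /= hE dq.
    - rewrite mulrDl (mulrDr (jac_pi a)) (mulrDr (1 - _)) bf fq ff.
      by rewrite addr0 add0r -eq addrC subrK.
    - rewrite mulrDl (mulrDr q) (mulrDr (1 - _)) qf fb ff.
      by rewrite addr0 add0r -bq -eq addrC subrK.
  have e0 : (1 - e) * e = 0 by rewrite mulrBl mul1r ee subrr.
  have e0' : e * (1 - e) = 0 by rewrite mulrBr mulr1 ee subrr.
  exists (e * w * e) => _; split; last by rewrite -mulrA ee.
    rewrite !mulrA he -{1}eh -[e * h]addr0 -e0' -mulrDr -(mulrA e) uw mulr1.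
    by rewrite ee.
  rewrite -mulrA eh -{1}he -mulrA -[h * e]addr0 -e0 -mulrDl (mulrA w) wu mul1r.
  by rewrite ee.
pose step g := a * g * H g.
have step_good g : good g -> good (step g).
  move=> gg; have [h1 h2 h3] := HP g gg; have [eg ge ge'] := gg; split.
  - by rewrite /step !mulrA.
  - by rewrite /step -mulrA h3.
  - by rewrite -[in RHS]h1 /step !rmorphM /= eb.
pose G k := iter k step e.
have G_good k : good (G k).
  by elim: k => [|k /step_good] //; split.
pose x k := (1 - G k.+1) * a * (1 - e).
have xJ k : x k \in jac A.
  apply/jac_pi_eq0; have [_ _ ge] := G_good k.+1.
  by rewrite !rmorphM rmorphB rmorph1 /= ge mulrBl mul1r eb subrr mul0r.
have gag g p : good p -> g = step p -> g * a * p = a * p.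
  move=> gp ->; have [h1 h2 h3] := HP p gp; have [eg ge _] := gp.
  by rewrite /step -h3 -!mulrA (mulrA e) h2 ge.
have GS k : G k.+2 - G k.+1 = x k * (G k.+1 - G k) * H (G k.+1).
  have [h1 _ _] := HP _ (G_good k.+1); have [eg ge _] := G_good k.+1.
  have [ep _ _] := G_good k; have gp := gag (G k.+1) (G k) (G_good k) erefl.
  rewrite [G k.+2]/(step (G k.+1)) /x /step.
  move: (G k.+1) (G k) (H _) h1 eg ge ep gp => g p h h1 eg ge ep gp.
  have -> : (1 - g) * a * (1 - e) * (g - p) = (1 - g) * a * g.
    have -> : (1 - g) * a * (1 - e) * (g - p) = (1 - g) * a * (g - p).
      rewrite -(mulrA _ (1 - e)) [(1 - e) * _]mulrBl mul1r.
      by rewrite (mulrBr e) eg ep subrr subr0.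
    have gap : (1 - g) * a * p = 0.
      by rewrite -mulrA mulrBl mul1r mulrA gp subrr.
    by rewrite mulrBr gap subr0.
  by rewrite !mulrBl mul1r -{2}ge -h1 !mulrA ge.
have [N] := Tnil x xJ.
have GE k : exists w, G k.+2 - G k.+1 = left_partial_prod x k * w.
  elim: k => [|k [w IHk]].
    by exists ((G 1%N - G 0%N) * H (G 1%N)); rewrite GS -mulrA.
  by exists (w * H (G k.+2)); rewrite GS IHk !mulrA.
move=> /(_ N (leqnn N)) xN.
have gS : step (G N.+1) = G N.+1.
  by apply/eqP; rewrite -subr_eq0; have [w] := GE N; rewrite xN mul0r => /eqP.
move: (G N.+1) (G_good N.+1) gS => g gg gS.
have [h1 h2 h3] := HP g gg; have [eg ge geq] := gg.
(* Off the image of [g], the element [a] is nilpotent: as that image is a-stable, the powers of (1 -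
   g)a are (1 - g)a^k. *)
have [|m zm] := Jnil ((1 - g) * a).
  apply/jac_pi_eq0; rewrite rmorphM rmorphB rmorph1 /= geq.
  by rewrite mulrBl mul1r eb subrr.
have ggg := gag g g gg (esym gS).
exists m; apply: (@triangular_group_inverse _ g (H g) (g * H g * e)) => //.
  by rewrite -!mulrA (mulrA e) h2.
apply/eqP; rewrite eq_sym -subr_eq0 -{1}[a ^+ _]mul1r -mulrBl.
suff <- : ((1 - g) * a) ^+ m.+1 = (1 - g) * a ^+ m.+1 by rewrite exprS zm mulr0.
have zz : (1 - g) * a = (1 - g) * a * (1 - g).
  by rewrite mulrBr mulr1 mulrBl mul1r mulrBl ggg subrr subr0.
elim: m {zm} => // m IHm.
by rewrite exprS IHm mulrA -zz -mulrA -exprS.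
Qed.

End RightPerfect.

(** * Passing to a subring *)

Section IdealPowers.
Variable A : pzRingType.
Implicit Types (I J : set A) (P : A -> Prop).

Lemma ideal_mul_prod I J y z : I y -> J z -> ideal_mul I J (y * z).
Proof. by move=> Iy Jz; exists 1%N, (fun=> y), (fun=> z); rewrite big_ord1. Qed.

Lemma ideal_mul_ind I J P :
    P 0 -> (forall x y, P x -> P y -> P (x + y)) ->
    (forall y z, I y -> J z -> P (y * z)) ->
  forall x, ideal_mul I J x -> P x.
Proof.
move=> P0 PD PM _ [m [y [z [Iy Jz ->]]]].
by apply: (big_ind P) => // i _; exact: PM.
Qed.

Lemma ideal_mul0 I J : ideal_mul I J 0.
Proof.
exists 0%N, (fun=> 0), (fun=> 0).
by split=> [[]|[]|] //; rewrite big_ord0.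
Qed.

Lemma ideal_mulD I J x y :
  ideal_mul I J x -> ideal_mul I J y -> ideal_mul I J (x + y).
Proof.
move=> [m [a [b [Ia Jb ->]]]] [m' [a' [b' [Ia' Jb' ->]]]].
pose join (c : 'I_m -> A) c' (i : 'I_(m + m')) :=
  match fintype.split i with inl j => c j | inr j => c' j end.
exists (m + m')%N, (join a a'), (join b b').
split=> [i|i|]; rewrite ?/join; [by case: fintype.split..|].
rewrite big_split_ord /=; congr (_ + _); apply: eq_bigr => i _.
  by rewrite (unsplitK (inl i) : fintype.split (lshift _ _) = _).
by rewrite (unsplitK (inr i) : fintype.split (rshift _ _) = _).
Qed.

Lemma ideal_exp_add I m n x : ideal_exp I (m + n) x ->
  ideal_mul (ideal_exp I m) (ideal_exp I n) x.
Proof.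
elim: n x => [|n IHn] x.
  by rewrite addn0 => Ix; rewrite -[x]mulr1; exact: ideal_mul_prod.
rewrite addnS; apply: ideal_mul_ind; first exact: ideal_mul0.
  by move=> y z; exact: ideal_mulD.
move=> y z /IHn + Iz; apply: (ideal_mul_ind (P := fun y => _ (y * z))).
- by rewrite mul0r; exact: ideal_mul0.
- by move=> u v Iu Iv; rewrite mulrDl; exact: ideal_mulD.
- by move=> u v Iu Iv; rewrite -mulrA; do 2?apply: ideal_mul_prod.
Qed.

(** [ideal_exp] adds factors on the right, [left_partial_prod] on the left. All multiples [x * a]
    are required in [I] because the zeroth power is the whole ring. *)
Lemma ideal_exp_lmul I n x y : (forall a, I (x * a)) -> ideal_exp I n y ->
  ideal_exp I n.+1 (x * y).
Proof.
move=> Ix; elim: n y => [|n IHn] y.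
  by move=> _; rewrite -[_ * _]mul1r; exact: ideal_mul_prod.
apply: (ideal_mul_ind (P := fun y => ideal_exp I n.+2 (x * y))).
- by rewrite mulr0; exact: ideal_mul0.
- by move=> u v Iu Iv; rewrite mulrDr; exact: ideal_mulD.
- by move=> u v Iu Iv; rewrite mulrA; apply: ideal_mul_prod => //; exact: IHn.
Qed.

Lemma left_partial_prod_ideal_exp (x : nat -> A) k :
  (forall i, x i \in jac A) ->
  ideal_exp [set` jac A] k.+1 (left_partial_prod x k).
Proof.
move=> xJ; have xI i a : [set` jac A] (x i * a) by apply: jacMr.
elim: k => [|k IHk]; last exact: ideal_exp_lmul.
by rewrite /= -[x 0%N]mulr1; apply: (@ideal_exp_lmul _ 0%N).
Qed.

Lemma left_partial_prod_eq0 (x : nat -> A) n k : left_partial_prod x n = 0 ->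
  (n <= k)%N -> left_partial_prod x k = 0.
Proof.
move=> xn /subnK <-; elim: (k - n)%N => [|d IHd] //=.
by rewrite IHd mulr0.
Qed.

Lemma left_partial_prod_addS (x : nat -> A) k i :
  left_partial_prod x (k + i).+1 =
  left_partial_prod (fun j => x (k + j).+1) i * left_partial_prod x k.
Proof.
elim: i => [|i IHi]; first by rewrite /= addn0.
by rewrite addnS [LHS]/= -/(left_partial_prod x (k + i).+1) IHi /= mulrA addnS.
Qed.

Lemma semiprimary_right_perfect : semiprimary A -> right_perfect A.
Proof.
move=> [Asl [n Jn]]; split=> // x xJ; exists n => k.
apply: left_partial_prod_eq0.
have : ideal_mul (ideal_exp [set` jac A] n) [set` jac A]
    (left_partial_prod x n).
  exact: left_partial_prod_ideal_exp.
rewrite Jn; apply: (ideal_mul_ind (P := fun y => y = 0)) => //.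
- by move=> _ _ -> ->; rewrite addr0.
- by move=> _ z -> _; rewrite mul0r.
Qed.

End IdealPowers.

(** * Radicals and idempotents along an injective ring morphism *)

Section Extension.
Variables (A B : pzRingType) (iota : {rmorphism B -> A}).
Hypothesis iota_inj : injective iota.

Definition jac_exp_sub n : Prop :=
  forall x, ideal_exp [set` jac B] n x -> iota x \in jac A.

Lemma jac_nilpotent_sub n : jac_exp_sub n -> jac_nilpotent A -> jac_nilpotent B.
Proof.
move=> Jn [m Jm]; exists (m * n)%N.
have sub k x : ideal_exp [set` jac B] (k * n) x ->
    ideal_exp [set` jac A] k (iota x).
  elim: k x => [|k IHk] x //; rewrite mulSn addnC => /ideal_exp_add.
  apply: (ideal_mul_ind (P := fun x => ideal_exp _ k.+1 (iota x))).
  - by rewrite rmorph0; exact: ideal_mul0.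
  - by move=> y z Iy Iz; rewrite rmorphD; exact: ideal_mulD.
  - move=> y z Iy Iz; rewrite rmorphM.
    by apply: ideal_mul_prod; [exact: IHk|exact: Jn].
apply/seteqP; split=> [x /sub|_ ->].
  by rewrite Jm => ix0; apply: iota_inj; rewrite rmorph0.
by case: (m * n)%N => // k; exact: ideal_mul0.
Qed.

Lemma right_T_nilpotent_sub n : jac_exp_sub n.+1 ->
  right_T_nilpotent [set` jac A] -> right_T_nilpotent [set` jac B].
Proof.
move=> Jn TA x xJ.
(* Blocks of n + 1 consecutive factors have products in Jac(B)^(n+1), hence in Jac(A). *)
pose y j := iota (left_partial_prod (fun i => x (j * n.+1 + i)%N) n).
have yE j : left_partial_prod y j = iota (left_partial_prod x (j * n.+1 + n)).
  have shift j' i : (j'.+1 * n.+1 + i = (j' * n.+1 + n + i).+1)%N.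
    by rewrite mulSnr addnS addSn.
  elim: j => [|j IHj] //.
  rewrite shift left_partial_prod_addS rmorphM -IHj /= /y.
  by congr (iota (left_partial_prod _ _) * _); apply/funext => i; rewrite shift.
have [|N yN] := TA y.
  by move=> j; apply/Jn/left_partial_prod_ideal_exp => i; exact: xJ.
exists (N * n.+1 + n)%N => k; apply: left_partial_prod_eq0.
by apply: iota_inj; rewrite -yE yN // rmorph0.
Qed.

Hypothesis A_semilocal : semilocal A.
Hypothesis B_spr : strongly_pi_regular B.

(** The image of Jac(B) in A / Jac(A) is nil by [jac_nil] and closed under products, so
    [left_annihilated_setT] makes it nilpotent. *)
Lemma ex_jac_exp_sub : exists n, jac_exp_sub n.+1.
Proof.
pose N := [set y | exists2 b, b \in jac B & y = jac_pi (iota b)].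
have [||n Nn] := @left_annihilated_setT _ N A_semilocal.
- move=> _ _ [b bJ ->] [c cJ ->]; exists (b * c); first exact: jacMr.
  by rewrite !rmorphM.
- move=> _ [b bJ ->]; have [n bn] := jac_nil B_spr bJ.
  by exists n; rewrite -!rmorphXn bn !rmorph0.
exists n => x Jx; apply/jac_pi_eq0.
have Nn1 : left_annihilated N n.+1 1 by rewrite /= Nn.
suff NE k y v : ideal_exp [set` jac B] k y -> left_annihilated N k v ->
    jac_pi (iota y) * v = 0 by rewrite -[LHS]mulr1; exact: NE Nn1.
elim: k y v => [|k IHk] y v; first by move=> _ ->; rewrite mulr0.
move=> + Nv; apply: (ideal_mul_ind (P := fun y => jac_pi (iota y) * v = 0)).
- by rewrite !rmorph0 mul0r.
- by move=> a b ab0 b0; rewrite !rmorphD mulrDl ab0 b0 addr0.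
- move=> a b Ja Jb; rewrite !rmorphM -mulrA; apply: IHk => //.
  by apply: Nv; exists b.
Qed.

Lemma semiperfect_sub : semiperfect B.
Proof.
split; last exact: strongly_pi_regular_idempotents_lift.
pose W_ e := exists2 W : set (jac_quot B), simple_sum W & W (jac_pi e).
suff [W Ws W1] : W_ 1 by exact: simple_sum_semisimple_artinian Ws W1.
apply: contrapT => nW1.
pose bad e := e * e = e /\ ~ W_ e.
pose eQ e : set (jac_quot A) := [set jac_pi (iota e) * y | y in setT].
pose P X := exists2 e, bad e & X = eQ e.
have [||_ [e [ee nWe] ->] emin] := @artinian_minimal _ P (eQ 1) A_semilocal.2.
- by move=> _ [e _ ->]; exact/right_ideal_lmul/right_ideal_setT.
- by exists 1 => //; split; rewrite ?mulr1.
(* By minimality [e] and [f] generate the same right ideal modulo Jac(A), so e - f is an idempotent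
   in Jac(A), hence 0. *)
have bad_eq f : bad f -> e * f = f -> f * e = f -> f = e.
  move=> bf ef fe; have [ff _] := bf.
  have sub : eQ f `<=` eQ e.
    move=> _ [y _ <-]; exists (jac_pi (iota f) * y) => //.
    by rewrite mulrA -!rmorphM ef.
  have [|y _ yE] := emin _ (ex_intro2 _ _ f bf erefl) sub (jac_pi (iota e)).
    by exists 1; rewrite ?mulr1.
  have pi_eq : jac_pi (iota e) = jac_pi (iota f).
    transitivity (jac_pi (iota f) * jac_pi (iota e)); last first.
      by rewrite -!rmorphM fe.
    by rewrite -yE mulrA -!rmorphM ff.
  apply/eqP; rewrite eq_sym -subr_eq0; apply/eqP.
  apply: iota_inj; rewrite rmorph0; apply: jac_idem.
    rewrite -rmorphM; congr (iota _).
    by rewrite mulrBr !mulrBl ee ef fe ff subrr subr0.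
  by rewrite rmorphB; apply/jac_piP.
(* Otherwise neither [u] nor e - u is bad, and neither is their sum [e]. *)
have primitive u : u * u = u -> e * u = u -> u * e = u -> u <> 0 -> u = e.
  move=> uu eu ue u0; apply: contrapT => nue.
  have goodW f : f * f = f -> e * f = f -> f * e = f -> f <> e -> W_ f.
    by move=> ff ef fe nfe; apply: contrapT => nWf; apply: nfe; exact: bad_eq.
  have [W Ws Wu] := goodW u uu eu ue nue.
  have [||||W' W's W'u] := goodW (e - u).
  - by rewrite mulrBr !mulrBl ee eu ue uu subrr subr0.
  - by rewrite mulrBr ee eu.
  - by rewrite mulrBl ee ue.
  - by move=> /eqP; rewrite -subr_eq0 addrAC subrr add0r oppr_eq0 => /eqP.
  have [W'' W''s [WW'' W'W'']] := simple_sum_join Ws W's.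
  apply: nWe; exists W'' => //; rewrite -[e](subrK u) rmorphD.
  apply: right_idealD; first exact: right_ideal_simple_sum.
    exact: W'W''.
  exact: WW''.
pose V := [set jac_pi e * y | y in setT].
have Vr : right_ideal V by exact/right_ideal_lmul/right_ideal_setT.
apply: nWe; exists (sumset [set 0] V); last first.
  apply: sub_sumsetr; first exact: right_ideal_set0.
  by exists 1; rewrite ?mulr1.
apply: simple_sumD; first exact: simple_sum0.
split=> // I Ir IV; have [I0|nI0] := pselect (I `<=` [set 0]); [by left|right].
have [y Iy y0] : exists2 y, I y & y <> 0.
  apply: contrapT => ny; apply: nI0 => y Iy; apply: contrapT => y0.
  by apply: ny; exists y.
have [q _ qE] := IV y Iy; have [x0 x0q] := jac_pi_surj q.
have [x xy ex] : exists2 x, jac_pi x = y & e * x = x.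
  by exists (e * x0); rewrite ?rmorphM ?mulrA /= ?x0q ?ee.
have [c xc] : exists c, ~ exists r, (1 - x * c) * r = 1.
  apply: contrapT => nc; apply: y0; rewrite -xy; apply/jac_pi_eq0/rinv_jac => c.
  by apply: contrapT => nr; apply: nc; exists c.
(* Were [s] nilpotent, so would be xc, against the choice of [c]. The Fitting idempotent of [s] is
   thus nonzero and lies under [e], so it equals [e], which puts the image of [e] in yQ. *)
pose s := x * c * e.
have es : e * s = s by rewrite /s !mulrA ex.
have se : s * e = s by rewrite /s -mulrA ee.
have snil n : s ^+ n <> 0.
  move=> sn; apply: xc; apply: (@nilpotent_inv _ _ n.+1).
  have -> : (x * c) ^+ n.+1 = s ^+ n * (x * c).
    elim: n {sn} => [|n IHn]; first by rewrite mul1r.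
    rewrite [RHS](_ : _ = s * (x * c) ^+ n.+1); last first.
      by rewrite IHn exprS !mulrA.
    have exc : e * (x * c) ^+ n.+1 = (x * c) ^+ n.+1 by rewrite exprS !mulrA ex.
    by rewrite exprS -[in LHS]exc mulrA.
  by rewrite sn mul0r.
have [n [g [n0 gi]]] := B_spr s; have [sg ssg sgg] := gi.
have sE : s ^+ n = s * s ^+ n.-1 by rewrite -exprS prednK.
have ue : s ^+ n * g = e.
  apply: primitive; first exact: group_inverse_idem.
  - by rewrite mulrA {1}sE mulrA es -sE.
  - by rewrite sg -mulrA -{1}(prednK n0) exprSr -mulrA se -exprSr prednK.
  - by move=> sg0; apply: (snil n); rewrite -ssg -mulrA sg0 mulr0.
move=> _ [z _ <-]; apply: right_idealMr => //.
rewrite -ue sE /s -!mulrA rmorphM /= xy.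
exact: right_idealMr.
Qed.

End Extension.

(** [group_inverse_comm] puts the group inverse in the commutant. The ring [E] is there because [T]
    need not lie in [A]: multiplication by a scalar of S need not be R-linear. *)
Lemma strongly_pi_regular_commutant (A B E : pzRingType)
    (alpha : {rmorphism A -> E}) (beta : {rmorphism B -> A}) (T : set E) :
    injective beta ->
    (forall a, (exists b, beta b = a) <->
               forall t, T t -> t * alpha a = alpha a * t) ->
  strongly_pi_regular A -> strongly_pi_regular B.
Proof.
move=> beta_inj commP sA b; have [n [g [n0 gi]]] := sA (beta b).
have giE : group_inverse (alpha (beta b ^+ n)) (alpha g).
  by have [bg bbg bgg] := gi; split; rewrite -!rmorphM; congr (alpha _).
have [g' g'E] : exists g', beta g' = g.
  apply/commP => t Tt; apply/esym/(group_inverse_comm giE).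
  by apply/esym; move: t Tt; apply/commP; exists (b ^+ n); rewrite rmorphXn.
exists n, g'; split=> //; move: gi; rewrite -g'E -rmorphXn /=.
by case=> bg bbg bgg; split; apply: beta_inj; rewrite !rmorphM.
Qed.

Lemma strongly_pi_regular_commutant_mx (A B E : pzRingType)
    (alpha : {rmorphism A -> E}) (beta : {rmorphism B -> A}) (T : set E) n :
    injective beta ->
    (forall a, (exists b, beta b = a) <->
               forall t, T t -> t * alpha a = alpha a * t) ->
  strongly_pi_regular 'M[A]_n -> strongly_pi_regular 'M[B]_n.
Proof.
move=> beta_inj commP; have scalE t (X : 'M[A]_n) :
    t%:M * map_mx alpha X = map_mx alpha X * t%:M <->
    forall i j, t * alpha (X i j) = alpha (X i j) * t.
  have -> : t%:M * map_mx alpha X = \matrix_(i, j) (t * alpha (X i j)).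
    by apply/matrixP => i j; rewrite [_ * _]mul_scalar_mx !mxE.
  have -> : map_mx alpha X * t%:M = \matrix_(i, j) (alpha (X i j) * t).
    apply/matrixP => i j.
    by rewrite -diag_const_mx [_ * diag_mx _]mul_mx_diag !mxE.
  split=> [/matrixP XE i j|XE]; first by have := XE i j; rewrite !mxE.
  by apply/matrixP => i j; rewrite !mxE.
(* Matrices over [B] form the commutant of the scalar matrices with entry in [T]. *)
apply: (@strongly_pi_regular_commutant _ _ _ (map_mx alpha) (map_mx beta)
  [set t%:M | t in T]).
  move=> X Y /matrixP XY; apply/matrixP => i j; apply: beta_inj.
  by have := XY i j; rewrite !mxE.
move=> X; split.
  move=> [Y <-] _ [t Tt <-]; apply/scalE => i j; rewrite mxE.
  by move: t Tt; apply/commP; exists (Y i j).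
move=> TX; have /choice[F FE] : forall ij, exists b, beta b = X ij.1 ij.2.
  move=> [i j]; apply/commP => t Tt /=.
  by apply/scalE: i j; apply: TX; exists t.
by exists (\matrix_(i, j) F (i, j)); apply/matrixP => i j; rewrite !mxE FE.
Qed.

Lemma pi_regular_mx1 (A : pzRingType) : pi_regular 'M[A]_1 -> pi_regular A.
Proof.
move=> /pi_regularP pA; apply/pi_regularP => a.
have [n [X]] := pA a%:M; rewrite -!rmorphXn /= => /matrixP/(_ 0 0) XE.
exists n, (X 0 0); move: XE.
by rewrite [_%:M * _]mul_scalar_mx !mxE eqxx !mulr1n.
Qed.

(** * Endomorphism rings *)

Section EndoRings.
Variables (S : pzRingType) (M : lmodType S^c).

Definition endo_restr (R R' : {pred S}) (sub : {subset R <= R'})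
    (f : endo M R') : endo M R :=
  Endo (endo_restr_subproof sub (endo_funP f)).

Section Restriction.
Variables (R R' : {pred S}) (sub : {subset R <= R'}).

Lemma endo_restr_zmod_morphism : zmod_morphism (endo_restr sub).
Proof. by move=> f g; apply/val_inj. Qed.

Lemma endo_restr_monoid_morphism : monoid_morphism (endo_restr sub).
Proof. by split=> [|f g]; apply/val_inj. Qed.

HB.instance Definition _ :=
  GRing.isZmodMorphism.Build _ _ (endo_restr sub) endo_restr_zmod_morphism.
HB.instance Definition _ :=
  GRing.isMonoidMorphism.Build _ _ (endo_restr sub) endo_restr_monoid_morphism.

Lemma endo_restr_inj : injective (endo_restr sub).
Proof. by move=> f g /(congr1 val) fg; apply/val_inj. Qed.

End Restriction.

Lemma scale_endo_subproof (s : S) :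
  (fun m : M => (s : S^c) *: m) \in is_endo pred0.
Proof. by apply/is_endoP; split=> // m1 m2; rewrite scalerDr. Qed.

Definition scale_endo (s : S) : endo M pred0 := Endo (scale_endo_subproof s).

Lemma sub_pred0 (R : {pred S}) : {subset (pred0 : {pred S}) <= R}.
Proof. by []. Qed.

Lemma sub_predT (R : {pred S}) : {subset R <= (predT : {pred S})}.
Proof. by []. Qed.

(* endo M pred0 is End(M_Z), which contains the scalar multiplications by S.  *)
Lemma endo_commutant (R : {pred S}) (a : endo M R) :
  (exists b, endo_restr (@sub_predT R) b = a) <->
  forall t, range scale_endo t ->
    t * endo_restr (@sub_pred0 R) a = endo_restr (@sub_pred0 R) a * t.
Proof.
split=> [[b <-] _ [s _ <-]|ac].
  by apply/val_inj/funext => m; rewrite /= endoZ.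
have aP : (a : M -> M) \in is_endo predT.
  apply/is_endoP; split=> [|s m _]; first exact: endoD.
  have := ac (scale_endo s) (ex_intro2 _ _ s I erefl).
  by move=> /(congr1 (fun f : endo M pred0 => f m)).
by exists (Endo aP); apply/val_inj.
Qed.

Lemma strongly_pi_regular_endo (R : {pred S}) :
  strongly_pi_regular (endo M R) -> strongly_pi_regular (endo M predT).
Proof.
apply: strongly_pi_regular_commutant (@endo_commutant R).
exact: endo_restr_inj.
Qed.

Lemma pi_infty_regular_endo (R : {pred S}) :
  pi_infty_regular (endo M R) -> pi_infty_regular (endo M predT).
Proof.
move=> pA n; have {pA}sA := pi_regular_strongly (pA n).
apply: strongly_pi_regular_pi_regular; move: sA.
apply: strongly_pi_regular_commutant_mx (@endo_commutant R).
exact: endo_restr_inj.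
Qed.

Lemma endo_semiperfect (R : {pred S}) :
    semilocal (endo M R) -> strongly_pi_regular (endo M R) ->
  semiperfect (endo M predT) /\
  exists n, jac_exp_sub (endo_restr (@sub_predT R)) n.+1.
Proof.
move=> slA /strongly_pi_regular_endo sB.
split; last exact: ex_jac_exp_sub.
exact: semiperfect_sub (@endo_restr_inj _ _ _) slA sB.
Qed.

Lemma jac_exp_sub_incl (R : {pred S}) n :
  jac_exp_sub (endo_restr (@sub_predT R)) n.+1 -> jac_exp_incl M R.
Proof.
move=> Jn; exists n.+1 => // f /Jn.
by have -> : endo_incl R f = endo_restr (@sub_predT R) f by apply/val_inj.
Qed.

End EndoRings.

Theorem corollary4p7 (S : pzRingType) (R : {pred S}) (M : lmodType S^c)
    (R_subring : subring_closed R) :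
  [/\ semiprimary (endo M R) ->
        semiprimary (endo M predT) /\ jac_exp_incl M R,
      right_perfect (endo M R) ->
        right_perfect (endo M predT) /\ jac_exp_incl M R,
      semiperfect (endo M R) /\ pi_infty_regular (endo M R) ->
        (semiperfect (endo M predT) /\ pi_infty_regular (endo M predT)) /\
        jac_exp_incl M R
    & semiperfect (endo M R) /\ pi_regular (endo M R) ->
        (semiperfect (endo M predT) /\ pi_regular (endo M predT)) /\
        jac_exp_incl M R].
Proof.
have inj := @endo_restr_inj S M R predT (@sub_predT S R).
split.
- move=> spA.
  have sA := right_perfect_strongly_pi_regular (semiprimary_right_perfect spA).
  have [slA nA] := spA; have [[slB _] [n Jn]] := endo_semiperfect slA sA.
  split; last exact: jac_exp_sub_incl Jn.
  by split=> //; exact: (jac_nilpotent_sub inj Jn nA).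
- move=> rpA; have sA := right_perfect_strongly_pi_regular rpA.
  have [slA nA] := rpA; have [[slB _] [n Jn]] := endo_semiperfect slA sA.
  split; last exact: jac_exp_sub_incl Jn.
  by split=> //; exact: (right_T_nilpotent_sub inj Jn nA).
- move=> [[slA _] pA].
  have sA := pi_regular_strongly (pi_regular_mx1 (pA 1%N)).
  have [spB [n Jn]] := endo_semiperfect slA sA.
  split; last exact: jac_exp_sub_incl Jn.
  by split=> //; exact: pi_infty_regular_endo pA.
- move=> [[slA _] /pi_regular_strongly sA].
  have [spB [n Jn]] := endo_semiperfect slA sA.
  split; last exact: jac_exp_sub_incl Jn.
  split=> //.
  exact/strongly_pi_regular_pi_regular/strongly_pi_regular_endo/sA.
Qed.
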